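(* Let $G$ be a $k\frac{1}{2}$-extendable graph on $\nu$ vertices. Then $\alpha(G)\leq (\nu-1)/2-k$. Moreover, this upper bound is sharp for all $k$ and $\nu$, i.e., for all such admissible $k$ and $\nu$ there is a $k\frac{1}{2}$-extendable graph on $\nu$ vertices with independence number exactly $(\nu-1)/2-k$.
   Context: All graphs are undirected, simple, finite and connected. $\alpha(G)$ is the independence number of $G$. A connected graph $G$ (of odd order) is $k\frac{1}{2}$-extendable if (1) for every vertex $v$ of $G$ there is a matching of size $k$ in $G-v$, and (2) for every vertex $v$ of $G$, every matching of size $k$ in $G-v$ is contained in a perfect matching of $G-v$.
   Formalization: The order is assumed to satisfy ν ≥ 2k+3, and ''admissible'' means ν odd with ν ≥ 2k+3; for ν = 2k+1 the complete graph is k½-extendable by the definition but has independence number 1 > 0, so the bound fails there. *)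

(* Defs.v *)
From mathcomp Require Import all_boot.

Set Implicit Arguments.
Unset Strict Implicit.
Unset Printing Implicit Defensive.

Record sgraph := SGraph {
  vertex :> finType;
  adj : rel vertex;
  adj_sym : symmetric adj;
  adj_irrefl : irreflexive adj
}.

Section Graphs.
Variable G : sgraph.
Implicit Types (A S : {set G}) (M : {set {set G}}).

Definition edges : {set {set G}} :=
  [set [set p.1; p.2] | p : G * G & adj p.1 p.2].

Definition connected : bool := [forall x : G, forall y : G, connect (@adj G) x y].

Definition independent S : bool :=
  [forall x in S, forall y in S, ~~ adj x y].

Definition independence_number : nat :=
  \max_(S : {set G} | independent S) #|S|.

(* Matchings of an induced subgraph G[A] are handled as sets of edges of G
   contained in A, so that G - v is the case A = [set~ v]. *)
Definition matching A M : bool :=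
  [&& M \subset edges, cover M \subset A & trivIset M].

Definition perfect_matching A M : bool := matching A M && (cover M == A).

(* half_extendable k is k 1/2-extendability.  It does not impose a lower bound
   on the order; in the degenerate order 2k + 1 a matching of size k in G - v is
   already perfect, so that every factor-critical graph of that order (such as
   the complete graph) qualifies. *)
Definition half_extendable (k : nat) : Prop :=
  [/\ connected,
      odd #|G|,
      forall v : G, exists2 M, matching [set~ v] M & #|M| = k
    & forall (v : G) M, matching [set~ v] M -> #|M| = k ->
        exists2 N, perfect_matching [set~ v] N & M \subset N].

End Graphs.

Arguments half_extendable : clear implicits.

(* Main.v *)
(** Fix [G] with [2m+1] vertices.  Exchanging along augmenting paths shows that
every matching of [G - v] with at most [k] edges, not only one with exactly [k],
extends to a perfect matching of [G - v].  Let [S] be independent and nonempty,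
and let [M] be a largest matching of at most [k] edges avoiding [S].  For [v]
outside [M], a perfect matching of [G - v] containing [M] has [m - |M|] further
edges, each meeting [S] at most once; and if [|M| < k], each meeting the rest
[T = V - S - V(M)] at most once, since [T] is then independent.  So neither
[S - v] nor [T - v] has more than [m - |M|] vertices; taking [v] in [T], then in
[S], bounds [S] and [T] by [m - |M|], against [|S| + |T| = 2(m - |M|) + 1].  When
[|M| = k] the bound on [S] is the theorem.

For sharpness, join an independent set of [m - k] vertices to a clique on the
other [m + k + 1]. *)
Require Import Defs.
From mathcomp Require Import all_boot.
From mathcomp Require Import zify.

Set Implicit Arguments.
Unset Strict Implicit.
Unset Printing Implicit Defensive.

(** * Matchings as edge sets, their covers, and exchange along augmenting paths *)

Lemma subset_of_card (T : finType) (A : {set T}) k :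
  k <= #|A| -> exists2 B : {set T}, B \subset A & #|B| = k.
Proof.
move=> lekA; exists [set x in take k (enum A)].
  by apply/subsetP => x; rewrite inE => /mem_take; rewrite mem_enum.
by rewrite cardsE (card_uniqP _) ?take_uniq ?enum_uniq // size_takel -?cardE.
Qed.

Section Matchings.
Variable G : sgraph.
Implicit Types (A S : {set G}) (M N : {set {set G}}).

Lemma edgesP (e : {set G}) :
  reflect (exists x y : G, adj x y /\ e = [set x; y]) (e \in edges G).
Proof.
apply: (iffP imsetP) => [[[x y] + ->]|[x [y [xy ->]]]]; last first.
  by exists (x, y); rewrite ?inE.
by rewrite inE; exists x, y.
Qed.

Lemma adj_neq (x y : G) : adj x y -> x != y.
Proof. by apply: contraTneq => ->; rewrite adj_irrefl. Qed.

Lemma card_edge (e : {set G}) : e \in edges G -> #|e| = 2.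
Proof. by move=> /edgesP[x [y [/adj_neq xy ->]]]; rewrite cards2 xy. Qed.

Lemma matching0 A : matching A set0.
Proof.
by rewrite /matching /cover /trivIset /cover !big_set0 cards0 !sub0set.
Qed.

Lemma matching_edge A M e : matching A M -> e \in M -> e \in edges G.
Proof. by case/and3P=> /subsetP sM _ _ /sM. Qed.

Lemma sub_cover M (e : {set G}) : e \in M -> e \subset cover M.
Proof. exact: bigcup_sup. Qed.

Lemma coverS M N : M \subset N -> cover M \subset cover N.
Proof.
move=> /subsetP sMN; apply/bigcupsP => e eM.
exact: sub_cover (sMN _ eM).
Qed.

Lemma coverU1 (e : {set G}) M : cover (e |: M) = e :|: cover M.
Proof. by rewrite /cover bigcup_setU big_set1. Qed.

Lemma matchingS A M N : N \subset M -> matching A M -> matching A N.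
Proof.
move=> sNM /and3P[eM cM tM]; apply/and3P; split.
- exact: subset_trans eM.
- exact: subset_trans (coverS sNM) cM.
- exact: trivIsetS tM.
Qed.

Lemma matching_subset A A' M : A \subset A' -> matching A M -> matching A' M.
Proof.
by move=> sA /and3P[eM cM tM]; apply/and3P; split=> //; apply: subset_trans sA.
Qed.

Lemma matching_within A A' M :
  matching A M -> cover M \subset A' -> matching A' M.
Proof. by case/and3P=> eM _ tM cM; apply/and3P. Qed.

Lemma matchingU1 A M (e : {set G}) : matching A M -> e \in edges G ->
  e \subset A -> [disjoint e & cover M] -> matching A (e |: M) /\ e \notin M.
Proof.
move=> /and3P[eM cM tM] eG eA dM.
(* Disjointness of [e] from the members of [M] yields [e \notin M] only when no member of [M] is
   empty. *)
have set0M : set0 \notin M.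
  by apply/negP=> /(subsetP eM)/card_edge; rewrite cards0.
have dMe f : f \in M -> [disjoint e & f].
  by move=> fM; apply: disjointWr (sub_cover fM) dM.
have [tMe eNM] := trivIsetU1 dMe tM set0M.
split=> //; apply/and3P; split=> //.
- by rewrite subUset sub1set eG.
- by rewrite coverU1 subUset eA.
Qed.

Lemma matchingD1 A M (e : {set G}) :
  matching A M -> e \in M -> matching (A :\: e) (M :\ e).
Proof.
move=> mM eM; have := matchingS (subD1set M e) mM.
move=> /matching_within; apply; case/and3P: mM => _ cM tM.
by rewrite coverD1 // setSD.
Qed.

Lemma card_cover_matching A M : matching A M -> #|cover M| = 2 * #|M|.
Proof.
move=> mM; have /and3P[_ _] := mM; rewrite /trivIset => /eqP <-.
rewrite mulnC -sum_nat_const; apply: eq_bigr => e eM.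
exact: card_edge (matching_edge mM eM).
Qed.

(* The augmenting path is followed edge by edge: a vertex [y] covered by [N] only
   starts it, with [N]-edge [b = {x, y}] and [M]-edge [a] at [x].  Deleting [b]
   from [N] and [a] from [M] leaves the rest of the path to the induction, after
   which one of [a] and [b] is put back, depending on whether the far end of [a]
   has been covered. *)
Lemma matching_augment A M N : matching A M -> matching A N -> #|M| < #|N| ->
  exists C, [/\ matching A C, #|C| = #|M|.+1 & cover M \subset cover C].
Proof.
have [n] := ubnP #|M|.
elim: n A M N => // n IHn A M N; rewrite ltnS => leMn mM mN ltMN.
have /subsetPn[y] : ~~ (cover N \subset cover M).
  apply: contraL ltMN => /subset_leq_card.
  by rewrite (card_cover_matching mM) (card_cover_matching mN) leq_mul2l leqNgt.
move=> /bigcupP[b bN yb] yNM.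
have bG := matching_edge mN bN.
have bA : b \subset A.
  by have /and3P[_ cN _] := mN; apply: subset_trans (sub_cover bN) cN.
have [dbM|] := boolP [disjoint b & cover M].
  have [mC bNM] := matchingU1 mM bG bA dbM.
  exists (b |: M); split=> //; first by rewrite cardsU1 bNM.
  by rewrite coverU1 subsetUr.
move=> /pred0Pn[x /andP[/= xb /bigcupP[a aM xa]]].
have aG := matching_edge mM aM.
have aA : a \subset A.
  by have /and3P[_ cM _] := mM; apply: subset_trans (sub_cover aM) cM.
have xy : x != y.
  by apply: contraNneq yNM => <-; apply/bigcupP; exists a.
have def_b : b = [set x; y].
  apply/esym/eqP; rewrite eqEcard subUset !sub1set xb yb.
  by rewrite (card_edge bG) cards2 xy.
have [/= z za zx] : exists2 z, z \in a & z != x.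
  have /card_gt0P[z] : 0 < #|a :\ x|.
    by rewrite -(ltn_add2l (x \in a)) -cardsD1 (card_edge aG) xa.
  by rewrite !inE => /andP[]; exists z.
have def_a : a = [set x; z].
  apply/esym/eqP; rewrite eqEcard subUset !sub1set xa za.
  by rewrite (card_edge aG) cards2 eq_sym zx.
have covM : cover (M :\ a) = cover M :\: a.
  by case/and3P: mM => _ _ tM; rewrite coverD1.
(* [M :\ a] avoids both ends of [b]: [x] is covered by [a] alone, and [y] is not covered by [M]. *)
have mM1 : matching (A :\: b) (M :\ a).
  apply: matching_within (matchingS (subD1set M a) mM) _.
  rewrite subsetD covM (subset_trans (subsetDl _ _)) /=; last by case/and3P: mM.
  rewrite def_b disjoint_sym disjoint_subset; apply/subsetP => w.
  rewrite !inE => /orP[]/eqP->; first by rewrite xa.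
  by rewrite (negPf yNM) andbF.
have cardM : #|M| = #|M :\ a|.+1 by rewrite (cardsD1 a M) aM.
have cardN : #|N| = #|N :\ b|.+1 by rewrite (cardsD1 b N) bN.
have [||C [mC cardC covC]] := IHn _ _ _ _ mM1 (matchingD1 mN bN).
- by rewrite -cardM.
- by rewrite -ltnS -cardM -cardN.
have mCA := matching_subset (subsetDl A b) mC.
have bC : [disjoint cover C & b].
  by case/and3P: mC => _ + _; rewrite subsetD => /andP[].
have [zC|zNC] := boolP (z \in cover C).
  have [mbC bNC] : matching A (b |: C) /\ b \notin C.
    by apply: matchingU1; rewrite // disjoint_sym.
  exists (b |: C); split=> //; first by rewrite cardsU1 bNC cardC -cardM.
  rewrite coverU1 -(setID (cover M) a) subUset -covM.
  rewrite (subset_trans covC (subsetUr _ _)) andbT.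
  apply: subset_trans (subsetIr _ _) _.
  by rewrite def_a subUset !sub1set !inE xb zC orbT.
have xNC : x \notin cover C by rewrite (disjointFl bC xb).
have [maC aNC] : matching A (a |: C) /\ a \notin C.
  apply: matchingU1 => //; rewrite def_a disjoint_subset.
  by apply/subsetP => w; rewrite !inE => /orP[]/eqP->.
exists (a |: C); split=> //; first by rewrite cardsU1 aNC cardC -cardM.
rewrite coverU1 -(setID (cover M) a) subUset -covM.
rewrite (subset_trans covC (subsetUr _ _)) andbT.
exact: subset_trans (subsetIr _ _) (subsetUl _ _).
Qed.

(** Augmentation may discard edges of [M] but never uncovers a vertex, so it can be iterated up to
    the size of [N]. *)
Lemma matching_augment_to A M N :
  matching A M -> matching A N -> #|M| <= #|N| ->
  exists C, [/\ matching A C, #|C| = #|N| & cover M \subset cover C].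
Proof.
move=> mM mN leMN; have [d] : exists d, #|N| = #|M| + d.
  by exists (#|N| - #|M|); rewrite subnKC.
elim: d M mM {leMN} => [|d IHd] M mM cN; first by exists M; rewrite cN addn0.
have [|C [mC cC sMC]] := matching_augment mM mN.
  by rewrite cN addnS ltnS leq_addr.
have [|D [mD cD sCD]] := IHd C mC; first by rewrite cN cC addnS.
by exists D; split=> //; apply: subset_trans sCD.
Qed.

(** * Extending small matchings to perfect matchings *)

Lemma perfect_matchingU A M N : matching A M ->
  perfect_matching (A :\: cover M) N -> perfect_matching A (M :|: N).
Proof.
move=> /and3P[eM cM tM] /andP[/and3P[eN _ tN] /eqP cN].
have cMN : cover (M :|: N) = A.
  have <- : cover M :|: cover N = A by rewrite cN -{1}(setIidPr cM) setID.
  exact: bigcup_setU.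
rewrite /perfect_matching cMN eqxx andbT /matching cMN subxx subUset eM eN.
by rewrite trivIsetU // cN disjoints_subset setCD subsetUr.
Qed.

Lemma card_perfect_matching (v : G) N :
  perfect_matching [set~ v] N -> #|G| = (2 * #|N|).+1.
Proof.
move=> /andP[mN /eqP cN].
rewrite -(card_cover_matching mN) cN cardsC1 prednK //.
by apply/card_gt0P; exists v.
Qed.

(** Induction on the deficit [k - #|M|]. Augment [M] to a matching [C] of [k] edges covering all
    that [M] covers, and extend [C] to a perfect matching [N]. An edge of [N] outside [C] misses the
    cover of [C], hence that of [M], and can be added to [M]. *)
Lemma half_extendable_extend k (v : G) M :
  half_extendable G k -> 2 * k + 3 <= #|G| ->
  matching [set~ v] M -> #|M| <= k ->
  exists2 N, perfect_matching [set~ v] N & M \subset N.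
Proof.
move=> [_ _ exK extK] ltkG mM leMk.
have [d] : exists d, k = #|M| + d by exists (k - #|M|); rewrite subnKC.
elim: d M mM {leMk} => [|d IHd] M mM ck.
  by apply: extK; rewrite // ck addn0.
have [K mK cK] := exK v.
have [|C [mC cC sMC]] := matching_augment_to mM mK.
  by rewrite cK ck leq_addr.
have [N pN sCN] := extK v C mC (etrans cC cK).
(* The order is at least [2 * k + 3], so [N] has at least [k + 1] edges. *)
have /subsetPn[e eN eNC] : ~~ (N \subset C).
  apply: contraL ltkG => /subset_leq_card; rewrite cC cK => leN.
  by rewrite (card_perfect_matching pN); lia.
have /andP[mN /eqP cN] := pN.
have eM : [disjoint e & cover M].
  apply: disjointWr sMC _; rewrite disjoint_sym disjoints_subset.
  apply/bigcupsP => f fC; rewrite -disjoints_subset.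
  have /and3P[_ _ /trivIsetP tN] := mN; apply: tN => //.
    exact: (subsetP sCN).
  by apply: contraNneq eNC => <-.
have eA : e \subset [set~ v] by rewrite -cN sub_cover.
have [meM eNM] := matchingU1 mM (matching_edge mN eN) eA eM.
have [|N' pN' sN'] := IHd _ meM; first by rewrite cardsU1 eNM ck addnS.
by exists N' => //; apply: subset_trans sN'; apply: subsetUr.
Qed.

(** * The upper bound on independent sets *)

Lemma card_independent_cover A M S : matching A M -> independent S ->
  #|S :&: cover M| <= #|M|.
Proof.
move=> mM /forall_inP indS.
have -> : S :&: cover M = \bigcup_(e in M) (S :&: e).
  by rewrite /cover big_distrr.
apply: (@leq_trans (\sum_(e in M) #|S :&: e|)).
  elim/big_rec2: _ => [|e n U _ leU]; first by rewrite cards0.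
  exact: leq_trans (leq_card_setU _ _) (leq_add (leqnn _) leU).
rewrite -sum1_card; apply: leq_sum => e.
move=> /(matching_edge mM)/edgesP[x [y [xy ->]]].
rewrite leqNgt; apply/negP => gt1.
have : S :&: [set x; y] == [set x; y].
  by rewrite eqEcard subsetIr cards2 (adj_neq xy).
move=> /eqP/setIidPr; rewrite subUset !sub1set => /andP[xS yS].
by have /forall_inP/(_ y yS) := indS x xS; rewrite xy.
Qed.

(** Every vertex of [S] other than [v] lies on an edge of [N], which is not in [M] because [S]
    avoids the cover of [M]; each such edge holds at most one vertex of [S]. *)
Lemma card_independent_avoiding (v : G) M N S :
  perfect_matching [set~ v] N -> M \subset N -> independent S ->
  [disjoint S & cover M] -> #|S :\ v| <= #|N| - #|M|.
Proof.
move=> /andP[mN /eqP cN] sMN indS dSM.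
have mD : matching [set~ v] (N :\: M) := matchingS (subsetDl N M) mN.
rewrite -(setIidPr sMN) -cardsD.
apply: leq_trans (card_independent_cover mD indS); apply: subset_leq_card.
apply/subsetP => x /setD1P[xv xS]; rewrite inE xS.
have : x \in cover N by rewrite cN !inE.
move=> /bigcupP[e eN xe]; apply/bigcupP; exists e => //.
rewrite inE eN andbT; apply/negP => eM.
by have := disjointFr dSM xS; rewrite (subsetP (sub_cover eM) x xe).
Qed.

Lemma half_extendable_independent k S :
  half_extendable G k -> 2 * k + 3 <= #|G| -> independent S ->
  #|S| <= (#|G| - 1) %/ 2 - k.
Proof.
move=> hG ltkG indS.
have [->|/set0Pn[s sS]] := eqVneq S set0; first by rewrite cards0.
pose P M := matching (~: S) M && (#|M| <= k).
have P0 : P set0 by rewrite /P matching0 cards0.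
have [M /andP[mM leMk] maxM] := arg_maxnP (fun M : {set {set G}} => #|M|) P0.
have cM : cover M \subset ~: S by case/and3P: mM.
have dSM : [disjoint S & cover M] by rewrite disjoint_sym disjoints_subset.
pose T := ~: S :\: cover M.
have dTM : [disjoint T & cover M].
  by rewrite disjoints_subset; apply/subsetP => x; rewrite !inE => /andP[].
have cardSTM : #|S| + #|T| + 2 * #|M| = #|G|.
  have := cardsD (~: S) (cover M); rewrite -/T (setIidPr cM).
  have := subset_leq_card cM; rewrite (card_cover_matching mM).
  by have := cardsC S; lia.
have avoid (v : G) : v \notin cover M -> exists N, [/\ #|G| = (2 * #|N|).+1,
    perfect_matching [set~ v] N & M \subset N].
  move=> vM; have mvM : matching [set~ v] M.
    by apply: matching_within mM _; rewrite subsetC sub1set inE.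
  have [N pN sMN] := half_extendable_extend hG ltkG mvM leMk.
  by exists N; split=> //; apply: card_perfect_matching pN.
have [Ns [cNs pNs sMNs]] := avoid s (negbT (disjointFr dSM sS)).
have leS := card_independent_avoiding pNs sMNs indS dSM.
have S_s : #|S| = #|S :\ s|.+1 by rewrite (cardsD1 s S) sS.
(* Write [#|G| = 2m + 1]. If [T] were empty, [#|S|] would be [2(m - #|M|) + 1], while [leS] gives at
   most [m - #|M| + 1]; this forces [m <= #|M| <= k], against [k < m]. *)
have /card_gt0P[t tT] : 0 < #|T|.
  by clear -ltkG cNs leMk leS S_s cardSTM; lia.
have tNS : t \notin S by move: tT; rewrite !inE => /andP[].
have [Nt [cNt pNt sMNt]] := avoid t (negbT (disjointFr dTM tT)).
(* Deleting [t] outside [S] removes the excess of one that [leS] leaves. *)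
have := card_independent_avoiding pNt sMNt indS dSM.
have S_t : #|S| = #|S :\ t| by rewrite (cardsD1 t S) (negPf tNS).
rewrite -S_t => leS'.
have [leMk'|ltMk] := leqP k #|M|.
  have eqMk : #|M| = k by apply/eqP; rewrite eqn_leq leMk leMk'.
  by rewrite cNt subn1 /= mulKn // -eqMk.
(* An edge inside [T] could be added to [M], still within [k] edges and off [S], against
   maximality. *)
have indT : independent T.
  apply/forall_inP => x xT; apply/forall_inP => y yT; apply/negP => xy.
  have eT : [set x; y] \subset T by rewrite subUset !sub1set xT.
  have eG : [set x; y] \in edges G by apply/edgesP; exists x, y.
  have [meM eNM] := matchingU1 mM eG (subset_trans eT (subsetDl _ _))
                       (disjointWl eT dTM).
  have cardeM : #|[set x; y] |: M| = #|M|.+1 by rewrite cardsU1 eNM.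
  have := maxM ([set x; y] |: M).
  by rewrite /P meM /= cardeM ltMk ltnn => /(_ isT).
have := card_independent_avoiding pNs sMNs indT dTM.
have sNT : s \notin T by rewrite !inE sS andbF.
have T_s : #|T| = #|T :\ s| by rewrite (cardsD1 s T) (negPf sNT).
by rewrite -T_s; clear -leS' ltkG cNs cNt leMk cardSTM; lia.
Qed.

End Matchings.

(** * Sharpness: complete split graphs *)

Section Sharpness.
Variables n a : nat.

(** The complete split graph: the ordinals below [a] are the independent side, and those from [a] on
    are adjacent to every other vertex. *)
Definition split_adj : rel 'I_n :=
  fun x y => (x != y) && ((a <= x) || (a <= y)).

Lemma split_adj_sym : symmetric split_adj.
Proof. by move=> x y; rewrite /split_adj eq_sym orbC. Qed.

Lemma split_adj_irrefl : irreflexive split_adj.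
Proof. by move=> x; rewrite /split_adj eqxx. Qed.

Definition split_graph := SGraph split_adj_sym split_adj_irrefl.

Definition small : {set split_graph} := [set x : 'I_n | x < a].

Lemma card_small : a <= n -> #|small| = a.
Proof.
move=> lean; have -> : small = [set widen_ord lean x | x in 'I_a].
  apply/setP=> x; rewrite inE; apply/idP/imsetP => [xa|[y _ ->]];
    last exact: (ltn_ord y).
  by exists (Ordinal xa) => //; apply: val_inj.
rewrite card_imset ?card_ord // => x y /(congr1 val) /= xy; exact: val_inj.
Qed.

Lemma independent_small : independent small.
Proof.
apply/forall_inP => x; rewrite inE => xa.
apply/forall_inP => y; rewrite inE => ya.
by rewrite /= /split_adj leqNgt xa leqNgt ya andbF.
Qed.

Lemma independence_number_split_graph :
  0 < a <= n -> independence_number split_graph = a.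
Proof.
move=> /andP[a0 lean]; apply/eqP; rewrite eqn_leq.
apply/andP; split; last first.
  apply: leq_trans (leq_bigmax_cond _ independent_small).
  by rewrite card_small.
apply/bigmax_leqP => S indS.
have [sS|/subsetPn[x xS]] := boolP (S \subset small).
  by rewrite -(card_small lean) subset_leq_card.
(* A vertex on the clique side is adjacent to all others, so [S] is the singleton of [x]; this is
   where [0 < a] enters. *)
rewrite inE -leqNgt => ax; apply: leq_trans a0.
rewrite -(cards1 (x : split_graph)); apply/subset_leq_card/subsetP => y yS.
move/forall_inP/(_ x xS)/forall_inP/(_ y yS): indS.
by rewrite /= /split_adj ax andbT negbK inE eq_sym.
Qed.

(** Greedy pairing: at most half of [A] is small, so some [y] is on the clique side. It is matched
    with a small vertex while one remains, and with any vertex afterwards, which keeps the bound for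
    the rest. *)
Lemma split_graph_perfect_matching (A : {set split_graph}) m :
  #|A| = 2 * m -> #|A :&: small| <= m -> exists N, perfect_matching A N.
Proof.
elim: m A => [|m IHm] A cA leA.
  exists set0; rewrite /perfect_matching matching0 /=.
  by rewrite /cover big_set0 eq_sym -cards_eq0 cA.
have cAD := cardsID small A.
have /card_gt0P[y] : 0 < #|A :\: small| by lia.
rewrite inE => /andP[yNs yA].
have cAy : #|A| = #|A :\ y|.+1 by rewrite (cardsD1 y A) yA.
have [x [xA xy xs]] : exists x, [/\ x \in A, x != y &
    (#|A :&: small| == 0) || (x \in small)].
  have [As0|/set0Pn[x]] := eqVneq (A :&: small) set0; last first.
    rewrite inE => /andP[xA xs]; exists x; rewrite xs orbT; split=> //.
    by apply: contraNneq yNs => <-.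
  have /card_gt0P[x] : 0 < #|A :\ y| by lia.
  by rewrite !inE => /andP[xy xA]; exists x; rewrite As0 cards0.
pose e : {set split_graph} := [set x; y].
have eA : e \subset A by rewrite subUset !sub1set xA yA.
have ce : #|e| = 2 by rewrite cards2 xy.
have [||N /andP[mN /eqP cN]] := IHm (A :\: e).
- by have := cardsD A e; rewrite (setIidPr eA) ce; lia.
- case/orP: xs => [/eqP As0|xs].
    apply: leq_trans (_ : #|A :&: small| <= _); last by rewrite As0.
    by apply: subset_leq_card; apply: setSI; apply: subsetDl.
  have xAs : x \in A :&: small by rewrite inE xA.
  rewrite -ltnS; apply: leq_trans leA.
  rewrite (cardsD1 x (A :&: small)) xAs ltnS; apply: subset_leq_card.
  apply/subsetP => z; rewrite !inE negb_or => /andP[/andP[/andP[zx _] zA] zs].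
  by rewrite zx zA.
have eG : e \in edges split_graph.
  apply/edgesP; exists x, y; split=> //=.
  by move: yNs; rewrite /split_adj xy inE -leqNgt orbC => ->.
have deN : [disjoint e & cover N].
  by rewrite cN disjoints_subset setCD subsetUr.
have [mU _] := matchingU1 (matching_subset (subsetDl A e) mN) eG eA deN.
exists (e |: N); rewrite /perfect_matching mU coverU1 cN.
by have := setID A e; rewrite (setIidPr eA) => ->; rewrite eqxx.
Qed.

Lemma connected_split_graph : a < n -> connected split_graph.
Proof.
move=> ltan; pose c : split_graph := Ordinal ltan.
have toc (x : split_graph) : connect (@adj split_graph) x c.
  have [->//|xc] := eqVneq x c.
  by apply: connect1; rewrite /= /split_adj xc leqnn orbT.
apply/forallP => x; apply/forallP => y; apply: connect_trans (toc x) _.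
by rewrite (sym_connect_sym (@adj_sym split_graph)) ?toc.
Qed.

End Sharpness.

(** Removing [v] and the [2k] vertices of a matching leaves [2(m - k)] vertices. The small side has
    only [m - k] in all, so at most half of the remainder is small and greedy pairing applies. *)
Lemma split_graph_half_extendable k m : k < m ->
  half_extendable (split_graph (2 * m).+1 (m - k)) k.
Proof.
move=> ltkm; set G := split_graph _ _.
have cG : #|G| = (2 * m).+1 by rewrite card_ord.
have lea : m - k <= (2 * m).+1 by lia.
have cs := card_small lea.
have cv (v : G) : #|[set~ v]| = 2 * m by rewrite cardsC1 cG.
have les (A : {set G}) : #|A :&: small _ _| <= m - k.
  by apply: leq_trans (subset_leq_card (subsetIr _ _)) _; rewrite cs.
split.
- by apply: connected_split_graph; lia.
- by rewrite cG /= oddM.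
(* A matching of size [k] is cut out of a perfect matching of [G - v], which has [m > k] edges. *)
- move=> v; have [|N pN] := split_graph_perfect_matching (cv v).
    by apply: leq_trans (les _) _; apply: leq_subr.
  have /andP[mN _] := pN; have := card_perfect_matching pN; rewrite cG => cN.
  have [|M sMN cM] := @subset_of_card _ N k; first by lia.
  by exists M => //; apply: matchingS mN.
- move=> v M mM cM.
  have sMv : cover M \subset [set~ v] by case/and3P: mM.
  have [||N pN] :=
      @split_graph_perfect_matching _ _ ([set~ v] :\: cover M) (m - k).
  + by rewrite cardsD (setIidPr sMv) cv (card_cover_matching mM) cM mulnBr.
  + exact: les.
  by exists (M :|: N); [exact: perfect_matchingU | exact: subsetUl].
Qed.

Theorem theorem11 :
  (forall (k : nat) (G : sgraph),
     half_extendable G k -> 2 * k + 3 <= #|G| ->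
     independence_number G <= (#|G| - 1) %/ 2 - k)
  /\
  (forall k nu : nat,
     odd nu -> 2 * k + 3 <= nu ->
     exists G : sgraph,
       [/\ #|G| = nu,
           half_extendable G k
         & independence_number G = (nu - 1) %/ 2 - k]).
Proof.
split=> [k G hG ltkG|k nu odd_nu ltknu].
  by apply/bigmax_leqP => S; apply: half_extendable_independent.
have [m def_nu] : exists m, nu = (2 * m).+1.
  by exists nu./2; rewrite mul2n -[LHS]odd_double_half odd_nu.
have ltkm : k < m by lia.
exists (split_graph nu (m - k)); rewrite {}def_nu; split.
- exact: card_ord.
- exact: split_graph_half_extendable.
- rewrite independence_number_split_graph; last by lia.
  by rewrite subn1 /= mulKn.
Qed.
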